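(* Let $k$ be an algebraically closed field, let $X$ be an algebraic variety over $k$ with an action of an algebraic group $G$, and let $(Y,H)$ be a core for this action. If there exists a pseudo-quotient $\pi: X\to\overline{X}$ for the action of $G$ on $X$, then $\pi$ restricts to a pseudo-quotient $\pi|_Y: Y\to\overline{X}$ for the action of $H$ on $Y$.
   Context: Pseudo-quotient: a surjective $G$-invariant regular morphism $\pi: X\to Y$ onto a variety such that for any disjoint $G$-invariant closed sets $W_1,W_2\subseteq X$ one has $\overline{\pi(W_1)}\cap\overline{\pi(W_2)}=\emptyset$. A subset $A\subseteq X$ is orbitwise-closed for the action of a group $H$ if $\overline{Ha}\subseteq A$ for every $a\in A$. Core: a pair $(Y,H)$ of a subvariety $Y\subseteq X$ and an algebraic subgroup $H\leq G$ such that: (i) $Y$ is orbitwise-closed for the action of $H$; (ii) for any $x\in X$, $\overline{Gx}\cap Y\neq\emptyset$; (iii) for any two disjoint $H$-invariant subsets $W_1,W_2\subseteq Y$ closed in $Y$, one has $\overline{GW_1}\cap\overline{GW_2}=\emptyset$ (closures in $X$). *)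

(* Defs.v *)
(* Algebraic varieties in the sense of Serre
   (FAC): topological spaces with a sheaf of k-valued functions, covered by
   finitely many affine open sets, and separated. They need not be
   irreducible. *)
From HB Require Import structures.
From mathcomp Require Import all_boot all_order all_algebra.
From mathcomp Require Import finmap all_classical topology.
From mathcomp Require Import -(notations) mpoly.

Set Implicit Arguments.
Unset Strict Implicit.
Unset Printing Implicit Defensive.

Import GRing.Theory.
Local Open Scope classical_set_scope.
Local Open Scope ring_scope.

(* A sheaf of k-valued functions is given by its germs: [regular_at x f] says
   that f is a regular function on some open neighbourhood of x (the values of
   f far from x are irrelevant). The regular functions on an open set U are
   those that are regular at every point of U; the two axioms say exactly that
   this defines a sheaf of functions with these germs. That the sections form
   k-algebras, etc., is automatic for varieties, which are locally affine. *)
HB.mixin Record isFunSpace (k : closedFieldType) T & Topological T := {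
  regular_at : T -> (T -> k) -> Prop;
  regular_at_near : forall (x : T) (f : T -> k),
    regular_at x f -> \forall y \near x, regular_at y f;
  regular_at_germ : forall (x : T) (f g : T -> k),
    (\forall y \near x, f y = g y) -> regular_at x f -> regular_at x g
}.

#[short(type="funSpaceType")]
HB.structure Definition FunSpace (k : closedFieldType) :=
  {T of isFunSpace k T & Topological T}.

Definition regular_morphism (k : closedFieldType) (X Y : funSpaceType k)
    (phi : X -> Y) : Prop :=
  continuous phi /\
  forall (x : X) (f : Y -> k),
    regular_at (phi x) f -> regular_at x (f \o phi).

Definition isomorphic (k : closedFieldType) (X Y : funSpaceType k) : Prop :=
  exists (phi : X -> Y) (psi : Y -> X),
    [/\ regular_morphism phi, regular_morphism psi,
        cancel phi psi & cancel psi phi].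

(* The regular functions on a subset are locally restrictions of regular
   functions on X; subvarieties carry this induced structure. *)

Section Subspace.
Context {k : closedFieldType} {X : funSpaceType k} (A : set X).

Definition sub_regular_at (a : set_type A) (f : set_type A -> k) : Prop :=
  exists2 g : X -> k, regular_at (set_val a) g &
    \forall b \near a, f b = g (set_val b).

Lemma set_val_near (a : set_type A) (P : X -> Prop) :
  (\forall x \near set_val a, P x) -> \forall b \near a, P (set_val b).
Proof. exact: (@initial_continuous _ _ (set_val : set_type A -> X) a P). Qed.

Lemma sub_regular_at_near a f :
  sub_regular_at a f -> \forall b \near a, sub_regular_at b f.
Proof.
case=> g /regular_at_near/set_val_near rg /near_join fg.
by near=> b; exists g; near: b.
Unshelve. all: by end_near.
Qed.

Lemma sub_regular_at_germ a (f g : set_type A -> k) :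
  (\forall b \near a, f b = g b) -> sub_regular_at a f -> sub_regular_at a g.
Proof.
move=> fg [h rh fh]; exists h => //.
by near=> b; rewrite -(near fg b)//; near: b.
Unshelve. all: by end_near.
Qed.

HB.instance Definition _ :=
  isFunSpace.Build k (set_type A) sub_regular_at_near sub_regular_at_germ.

End Subspace.

(* An alias, so that the Zariski topology does not compete with the topology
   of pointwise convergence. *)
Definition affine_space (k : closedFieldType) (n : nat) : Type := 'I_n -> k.

HB.instance Definition _ (k : closedFieldType) (n : nat) :=
  gen_eqMixin (affine_space k n).
HB.instance Definition _ (k : closedFieldType) (n : nat) :=
  gen_choiceMixin (affine_space k n).

Section AffineSpace.
Context (k : closedFieldType) (n : nat).
Local Notation A := (affine_space k n).
Local Notation poly_fun p x := (meval (x : 'I_n -> k) p).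

Definition zero_locus (S : set (mpoly n k)) : set A :=
  [set x | forall p, S p -> poly_fun p x = 0].

Definition zariski_open (U : set A) : Prop :=
  exists S, U = ~` zero_locus S.

Lemma zariski_openT : zariski_open setT.
Proof.
exists [set (1 : mpoly n k)]; rewrite -[LHS]setCK setCT; congr (~` _).
apply/seteqP; split=> x //= /(_ 1 erefl).
by rewrite meval1 => /eqP; rewrite oner_eq0.
Qed.

Lemma zariski_openI : setI_closed zariski_open.
Proof.
move=> _ _ [S ->] [T ->].
exists [set r | exists p q, [/\ S p, T q & r = p * q]].
rewrite -setCU; congr (~` _); apply/seteqP; split=> x /=.
  case=> x0 _ [p [q [Sp Tq ->]]]; rewrite mevalM.
    by rewrite (x0 p Sp) mul0r.
  by rewrite (x0 q Tq) mulr0.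
move=> xST; apply: contrapT => /not_orP[/existsNP[p /not_implyP[Sp px]]].
move=> /existsNP[q /not_implyP[Tq qx]].
have /eqP := xST (p * q) (ex_intro _ p (ex_intro _ q (And3 Sp Tq erefl))).
by rewrite mevalM mulf_eq0 => /orP[] /eqP.
Qed.

Lemma zariski_open_bigU (I : Type) (f : I -> set A) :
  (forall i, zariski_open (f i)) -> zariski_open (\bigcup_i f i).
Proof.
move=> /choice[S fS]; exists (\bigcup_i S i).
rewrite -[LHS]setCK setC_bigcup; congr (~` _); apply/seteqP; split=> x /=.
  move=> xf p [i _ Sp]; have := xf i Logic.I.
  by rewrite fS => /contrapT; apply.
by move=> xS i _; rewrite fS; apply => p Sp; apply: xS; exists i.
Qed.

HB.instance Definition _ := isOpenTopological.Build A
  zariski_openT zariski_openI zariski_open_bigU.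

Definition affine_regular_at (x : A) (f : A -> k) : Prop :=
  exists p q : mpoly n k, poly_fun q x != 0 /\
    \forall y \near x, poly_fun q y != 0 /\ f y = poly_fun p y / poly_fun q y.

Lemma affine_regular_at_near x f :
  affine_regular_at x f -> \forall y \near x, affine_regular_at y f.
Proof.
case=> p [q [_ /near_join fpq]]; near=> y; exists p, q.
have fy := near fpq y; split; last exact: fy.
by case: (nbhs_singleton (fy _)).
Unshelve. all: by end_near.
Qed.

Lemma affine_regular_at_germ x (f g : A -> k) :
  (\forall y \near x, f y = g y) ->
  affine_regular_at x f -> affine_regular_at x g.
Proof.
move=> fg [p [q [qx fpq]]]; exists p, q; split=> //.
by near=> y; rewrite -(near fg y)//; near: y.
Unshelve. all: by end_near.
Qed.

HB.instance Definition _ :=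
  isFunSpace.Build k A affine_regular_at_near affine_regular_at_germ.

End AffineSpace.

Definition affine (k : closedFieldType) (X : funSpaceType k) : Prop :=
  exists (n : nat) (Z : set (affine_space k n)),
    closed Z /\ isomorphic X (set_type Z).

(* The topology is not the product topology: it is generated by the sets
   where a function sum_i a_i(x) b_i(y), with a_i regular on an open U and b_i
   regular on an open V, does not vanish on U x V. The regular functions are
   locally the quotients of such functions. *)
Definition zprod (X Y : Type) : Type := (X * Y)%type.

HB.instance Definition _ (X Y : choiceType) :=
  Choice.copy (zprod X Y) (X * Y)%type.

Section Product.
Context {k : closedFieldType} {X Y : funSpaceType k}.
Local Notation XY := (zprod X Y).

Definition tensor n (a : 'I_n -> X -> k) (b : 'I_n -> Y -> k) (p : XY) : k :=
  \sum_(i < n) a i p.1 * b i p.2.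

Definition zprod_principal (W : set XY) : Prop :=
  exists (U : set X) (V : set Y) n (a : 'I_n -> X -> k) (b : 'I_n -> Y -> k),
    [/\ open U, open V,
        forall i x, U x -> regular_at x (a i),
        forall i y, V y -> regular_at y (b i) &
        W = [set p | [/\ U p.1, V p.2 & tensor a b p != 0]]].

HB.instance Definition _ :=
  isSubBaseTopological.Build XY zprod_principal id.

Lemma zprod_principal_open W : zprod_principal W -> open W.
Proof.
move=> W_; exists [set W]; last by rewrite bigcup_set1.
move=> _ ->; exists [fset W]%fset; last by rewrite set_fset1 bigcap_set1.
by move=> V /fset1P ->; exact: mem_set.
Qed.

Definition zprod_regular_at (p : XY) (f : XY -> k) : Prop :=
  exists m (a : 'I_m -> X -> k) (b : 'I_m -> Y -> k)
         n (c : 'I_n -> X -> k) (d : 'I_n -> Y -> k),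
    [/\ forall i, regular_at p.1 (a i) /\ regular_at p.2 (b i),
        forall i, regular_at p.1 (c i) /\ regular_at p.2 (d i),
        tensor c d p != 0 &
        \forall q \near p, f q = tensor a b q / tensor c d q].

Lemma zprod_regular_at_near p f :
  zprod_regular_at p f -> \forall q \near p, zprod_regular_at q f.
Proof.
case=> m [a [b [n [c [d [ab cd cdp /near_join fE]]]]]].
pose U := [set x | (forall i, regular_at x (a i)) /\
                   (forall i, regular_at x (c i))]°.
pose V := [set y | (forall i, regular_at y (b i)) /\
                   (forall i, regular_at y (d i))]°.
have near_reg (Z : funSpaceType k) (z : Z) l (e : 'I_l -> Z -> k) :
    (forall i, regular_at z (e i)) ->
    \forall y \near z, forall i, regular_at y (e i).
  by move=> ez; apply: filter_forall => i; exact: regular_at_near.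
have UVp : \forall q \near p, [/\ U q.1, V q.2 & tensor c d q != 0].
  apply: open_nbhs_nbhs; split.
    apply: zprod_principal_open; exists U, V, n, c, d; split=> //.
    - exact: open_interior.
    - exact: open_interior.
    - by move=> i x /interior_subset[].
    - by move=> i y /interior_subset[].
  by split=> //=; apply: filterI; apply: near_reg => i;
    [case: (ab i)|case: (cd i)|case: (ab i)|case: (cd i)].
near=> q.
have [] : [/\ U q.1, V q.2 & tensor c d q != 0] by near: q.
move=> /interior_subset[aq cq] /interior_subset[bq dq] cdq.
exists m, a, b, n, c, d; split=> [i|i||].
- by split.
- by split.
- by [].
- by near: q.
Unshelve. all: by end_near.
Qed.

Lemma zprod_regular_at_germ p (f g : XY -> k) :
  (\forall q \near p, f q = g q) ->
  zprod_regular_at p f -> zprod_regular_at p g.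
Proof.
move=> fg [m [a [b [n [c [d [ab cd cdp fabcd]]]]]]].
exists m, a, b, n, c, d; split=> //.
by near=> q; rewrite -(near fg q)//; near: q.
Unshelve. all: by end_near.
Qed.

HB.instance Definition _ :=
  isFunSpace.Build k XY zprod_regular_at_near zprod_regular_at_germ.

End Product.

HB.mixin Record isVariety (k : closedFieldType) X & FunSpace k X := {
  variety_affine_cover : exists (n : nat) (U : 'I_n -> set X),
    [/\ forall i, open (U i), forall i, affine (set_type (U i)) &
        \bigcup_i U i = setT];
  variety_separated : closed [set p : zprod X X | p.1 = p.2]
}.

#[short(type="varietyType")]
HB.structure Definition Variety (k : closedFieldType) :=
  {X of isVariety k X & FunSpace k X}.

Definition locally_closed (T : topologicalType) (A : set T) : Prop :=
  exists U C : set T, [/\ open U, closed C & A = U `&` C].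

HB.mixin Record isRegularGroup (k : closedFieldType) G
    & FunSpace k G & Group G := {
  mulg_regular : regular_morphism (fun p : zprod G G => (p.1 * p.2)%g);
  invg_regular : regular_morphism (fun g : G => (g^-1)%g)
}.

#[short(type="funGroupType")]
HB.structure Definition FunGroup (k : closedFieldType) :=
  {G of isRegularGroup k G & FunSpace k G & Group G}.

#[short(type="algGroupType")]
HB.structure Definition AlgGroup (k : closedFieldType) :=
  {G of FunGroup k G & Variety k G}.

Record closedSubgroup (k : closedFieldType) (G : funGroupType k) :=
  ClosedSubgroup {
    subgroup_set :> set G;
    subgroup_closed : closed subgroup_set;
    subgroup1 : subgroup_set 1%g;
    subgroupM : forall g h,
      subgroup_set g -> subgroup_set h -> subgroup_set (g * h)%g;
    subgroupV : forall g, subgroup_set g -> subgroup_set (g^-1)%g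
  }.

Lemma set_valP (T : Type) (A : set T) (x : set_type A) : A (set_val x).
Proof. exact: set_mem (valP x). Qed.

Section Corestriction.
Context {k : closedFieldType}.

Lemma set_val_regular (X : funSpaceType k) (A : set X) :
  regular_morphism (set_val : set_type A -> X).
Proof.
split; first exact: initial_continuous.
by move=> a f rf; exists f => //; near=> b.
Unshelve. all: by end_near.
Qed.

Lemma comp_regular (X Y Z : funSpaceType k) (f : X -> Y) (g : Y -> Z) :
  regular_morphism f -> regular_morphism g -> regular_morphism (g \o f).
Proof.
move=> [cf rf] [cg rg]; split=> [x|x h /rg/rf//].
by apply: continuous_comp; [exact: cf|exact: cg].
Qed.

Lemma corestrict_regular (X Z : funSpaceType k) (A : set X)
    (f : Z -> set_type A) :
  regular_morphism (set_val \o f) -> regular_morphism f.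
Proof.
case=> cf rf; have cf' : continuous f.
  apply/continuousP => _ [W oW <-].
  by move/continuousP: cf; apply.
split=> // z g [h /rf rh gh]; apply: regular_at_germ rh.
have gfh : \forall y \near z, g (f y) = h (set_val (f y)) := cf' z _ gh.
by near=> y; rewrite /= (near gfh y).
Unshelve. all: by end_near.
Qed.

Lemma fset_bigcap_open (T : topologicalType) (I : choiceType)
    (F : {fset I}%fset) (P : I -> set T) :
  (forall i, i \in F -> open (P i)) -> open (\bigcap_(i in [set` F]) P i).
Proof.
move=> Po; rewrite openE => x Px; apply: filter_bigI => i iF.
by apply: open_nbhs_nbhs; split; [exact: Po|exact: Px].
Qed.

Lemma zprod_map_regular (X Y X' Y' : funSpaceType k) (f : X -> X')
    (g : Y -> Y') : regular_morphism f -> regular_morphism g ->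
  regular_morphism (fun p : zprod X Y => (f p.1, g p.2) : zprod X' Y').
Proof.
move=> [cf rf] [cg rg]; set fg : zprod X Y -> zprod X' Y' := fun p => _.
have tE n a b p : tensor a b (fg p) =
    @tensor _ X Y n (fun i => a i \o f) (fun i => b i \o g) p by [].
have cfg : continuous fg.
  apply/continuousP => _ [D DP <-]; rewrite preimage_bigcup.
  apply: bigcup_open => _ /DP[F FP <-]; rewrite preimage_bigcap.
  apply: fset_bigcap_open => W /FP/set_mem[U [V [n [a [b [oU oV ra rb ->]]]]]].
  apply: zprod_principal_open.
  exists (f @^-1` U), (g @^-1` V), n, (fun i => a i \o f), (fun i => b i \o g).
  split=> //.
  - by move/continuousP: cf; apply.
  - by move/continuousP: cg; apply.
  - by move=> i x Ux; apply/rf/ra.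
  - by move=> i y Vy; apply/rg/rb.
split=> // p h [m [a [b [n [c [d [ab cd cdp hE]]]]]]].
exists m, (fun i => a i \o f), (fun i => b i \o g).
exists n, (fun i => c i \o f), (fun i => d i \o g); split=> //.
- by move=> i; have [/rf ? /rg ?] := ab i; split.
- by move=> i; have [/rf ? /rg ?] := cd i; split.
- exact: cfg p _ hE.
Qed.

End Corestriction.

Section Subgroup.
Context {k : closedFieldType} {G : funGroupType k} (H : closedSubgroup G).
Local Notation HT := (set_type (subgroup_set H)).

Definition subgroup_one : HT := SigSub (mem_set (subgroup1 H)).
Definition subgroup_mul (g h : HT) : HT :=
  SigSub (mem_set (subgroupM (set_valP g) (set_valP h))).
Definition subgroup_inv (g : HT) : HT :=
  SigSub (mem_set (subgroupV (set_valP g))).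

Lemma subgroup_mulA : associative subgroup_mul.
Proof. by move=> x y z; apply: val_inj => /=; rewrite mulgA. Qed.
Lemma subgroup_mul1g : left_id subgroup_one subgroup_mul.
Proof. by move=> x; apply: val_inj => /=; rewrite mul1g. Qed.
Lemma subgroup_mulg1 : right_id subgroup_one subgroup_mul.
Proof. by move=> x; apply: val_inj => /=; rewrite mulg1. Qed.
Lemma subgroup_mulV : left_inverse subgroup_one subgroup_inv subgroup_mul.
Proof. by move=> x; apply: val_inj => /=; rewrite mulVg. Qed.
Lemma subgroup_Vmul : right_inverse subgroup_one subgroup_inv subgroup_mul.
Proof. by move=> x; apply: val_inj => /=; rewrite mulgV. Qed.

HB.instance Definition _ := isGroup.Build HT
  subgroup_mulA subgroup_mul1g subgroup_mulg1 subgroup_mulV subgroup_Vmul.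

Lemma subgroup_mul_regular :
  regular_morphism (fun p : zprod HT HT => (p.1 * p.2)%g).
Proof.
apply: corestrict_regular.
exact: (comp_regular (zprod_map_regular (set_val_regular H)
  (set_val_regular H)) mulg_regular).
Qed.

Lemma subgroup_inv_regular : regular_morphism (fun g : HT => (g^-1)%g).
Proof.
apply: corestrict_regular.
exact: (comp_regular (set_val_regular H) invg_regular).
Qed.

HB.instance Definition _ :=
  isRegularGroup.Build k HT subgroup_mul_regular subgroup_inv_regular.

End Subgroup.

Record regularAction (k : closedFieldType) (G : funGroupType k)
    (X : funSpaceType k) := RegularAction {
  act :> G -> X -> X;
  act1 : forall x, act 1%g x = x;
  actM : forall g h x, act (g * h)%g x = act g (act h x);
  act_regular : regular_morphism (fun p : zprod G X => act p.1 p.2)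
}.

Section PseudoQuotient.
Context {k : closedFieldType} {G : funGroupType k} {X : funSpaceType k}.
Variable alpha : regularAction G X.

Definition translates (S : set G) (W : set X) : set X :=
  [set alpha s w | s in S & w in W].

Definition invariant_set (S : set G) (W : set X) : Prop :=
  translates S W `<=` W.

(* Stated for a regular action on any space with functions, so that it applies
   to a locally closed subset with its induced structure. *)
Record pseudo_quotient (Xbar : varietyType k) (pi : X -> Xbar) : Prop :=
  PseudoQuotient {
    pq_regular : regular_morphism pi;
    pq_surjective : forall y, exists x, pi x = y;
    pq_invariant : forall g x, pi (alpha g x) = pi x;
    pq_separates : forall W1 W2 : set X,
      closed W1 -> closed W2 ->
      invariant_set setT W1 -> invariant_set setT W2 ->
      W1 `&` W2 = set0 ->
      closure (pi @` W1) `&` closure (pi @` W2) = set0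
  }.

Definition orbitwise_closed (S : set G) (A : set X) : Prop :=
  forall a, A a -> closure (translates S [set a]) `<=` A.

Definition closed_in (Y W : set X) : Prop :=
  exists2 C, closed C & W = Y `&` C.

Record core (Y : set X) (H : closedSubgroup G) : Prop := Core {
  core_subvariety : locally_closed Y;
  core_orbitwise_closed : orbitwise_closed H Y;
  core_meets : forall x, closure (translates setT [set x]) `&` Y !=set0;
  core_separates : forall W1 W2 : set X,
    closed_in Y W1 -> closed_in Y W2 ->
    invariant_set H W1 -> invariant_set H W2 ->
    W1 `&` W2 = set0 ->
    closure (translates setT W1) `&` closure (translates setT W2) = set0
}.

Lemma core_stable Y (H : closedSubgroup G) (c : core Y H)
    (h : set_type H) (y : set_type Y) : Y (alpha (set_val h) (set_val y)).
Proof.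
apply: (core_orbitwise_closed c (set_valP y)); apply: subset_closure.
exists (set_val h); first exact: set_valP.
by exists (set_val y).
Qed.

Definition core_act Y (H : closedSubgroup G) (c : core Y H)
    (h : set_type H) (y : set_type Y) : set_type Y :=
  SigSub (mem_set (core_stable c h y)).

Section CoreAction.
Context (Y : set X) (H : closedSubgroup G) (c : core Y H).

Lemma core_act1 y : core_act c 1%g y = y.
Proof. by apply: val_inj => /=; exact: act1. Qed.

Lemma core_actM g h y : core_act c (g * h)%g y = core_act c g (core_act c h y).
Proof. by apply: val_inj => /=; exact: actM. Qed.

Lemma core_act_regular : regular_morphism
  (fun p : zprod (set_type H) (set_type Y) => core_act c p.1 p.2).
Proof.
apply: corestrict_regular.
exact: (comp_regular (zprod_map_regular (set_val_regular H)
  (set_val_regular Y)) (act_regular alpha)).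
Qed.

Definition core_action : regularAction (set_type H) (set_type Y) :=
  RegularAction core_act1 core_actM core_act_regular.

End CoreAction.
End PseudoQuotient.

(* Main.v *)
(* A pseudo-quotient pi is constant on orbit closures because points of a
   variety are closed, and every orbit closure meets Y, so pi is onto from Y.
   For separation, disjoint H-invariant closed subsets of Y have disjoint
   G-saturation closures by the core property; these closures are G-invariant,
   since each g acts continuously, so pi separates them. *)
Require Import Defs.
From HB Require Import structures.
From mathcomp Require Import all_boot all_order all_algebra.
From mathcomp Require Import all_classical topology.
From mathcomp Require Import -(notations) mpoly.

Set Implicit Arguments.
Unset Strict Implicit.
Unset Printing Implicit Defensive.

Import GRing.Theory.
Local Open Scope classical_set_scope.
Local Open Scope ring_scope.

(* Needed for y |-> (x, y) to be continuous into [zprod]. The axioms of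
   [isFunSpace] do not give this; it is local, and holds on affine spaces. *)
Definition nonvanishing_near (k : closedFieldType) (X : funSpaceType k)
    (x : X) : Prop :=
  forall n (a : 'I_n -> k) (b : 'I_n -> X -> k),
    (forall i, regular_at x (b i)) -> \sum_(i < n) a i * b i x != 0 ->
    \forall y \near x, \sum_(i < n) a i * b i y != 0.

(** * Nonvanishing of regular functions and closedness of points on affine space *)

Section AffineSpace.
Context (k : closedFieldType) (n : nat).
Local Notation A := (affine_space k n).
Local Notation poly_fun p x := (meval (x : 'I_n -> k) p).

Lemma poly_fun_neq0_open (p : mpoly n k) :
  open [set x : A | poly_fun p x != 0].
Proof.
exists [set p]; apply/seteqP; split=> x /=.
  by move=> /eqP px /(_ _ erefl).
by move=> px; apply/eqP => px0; apply: px => _ ->.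
Qed.

Lemma poly_fun_neq0_near (p : mpoly n k) (x : A) :
  poly_fun p x != 0 -> \forall y \near x, poly_fun p y != 0.
Proof.
move=> px; apply: open_nbhs_nbhs; split=> //; exact: poly_fun_neq0_open.
Qed.

Lemma affine_regular_cst (x : A) (c : k) : affine_regular_at x (cst c).
Proof.
exists (mpolyC n c), 1; rewrite meval1; split; first exact: oner_neq0.
by near=> y; rewrite meval1 mevalC divr1 oner_neq0.
Unshelve. all: by end_near.
Qed.

Lemma affine_regularD (x : A) (f g : A -> k) :
  affine_regular_at x f -> affine_regular_at x g ->
  affine_regular_at x (fun y => f y + g y).
Proof.
move=> [p [q [qx fE]]] [r [s [sx gE]]].
exists (p * s + r * q), (q * s); split; first by rewrite mevalM mulf_neq0.
near=> y.
have [qy ->] : poly_fun q y != 0 /\ f y = poly_fun p y / poly_fun q y by near: y.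
have [sy ->] : poly_fun s y != 0 /\ g y = poly_fun r y / poly_fun s y by near: y.
by rewrite mevalD !mevalM mulf_neq0// addf_div.
Unshelve. all: by end_near.
Qed.

Lemma affine_regularM (x : A) (f g : A -> k) :
  affine_regular_at x f -> affine_regular_at x g ->
  affine_regular_at x (fun y => f y * g y).
Proof.
move=> [p [q [qx fE]]] [r [s [sx gE]]].
exists (p * r), (q * s); split; first by rewrite mevalM mulf_neq0.
near=> y.
have [qy ->] : poly_fun q y != 0 /\ f y = poly_fun p y / poly_fun q y by near: y.
have [sy ->] : poly_fun s y != 0 /\ g y = poly_fun r y / poly_fun s y by near: y.
by rewrite !mevalM mulf_neq0// mulf_div.
Unshelve. all: by end_near.
Qed.

Lemma affine_regular_sum (x : A) m (f : 'I_m -> A -> k) :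
  (forall i, affine_regular_at x (f i)) ->
  affine_regular_at x (fun y => \sum_(i < m) f i y).
Proof.
elim: m f => [|m IH] f fx.
  suff -> : (fun y => \sum_(i < 0) f i y) = cst 0 by exact: affine_regular_cst.
  by apply/funext => y; rewrite big_ord0.
suff -> : (fun y => \sum_(i < m.+1) f i y) =
    (fun y => f ord0 y + \sum_(i < m) f (lift ord0 i) y).
  by apply: affine_regularD => //; apply: IH => i.
by apply/funext => y; rewrite big_ord_recl.
Qed.

(** Near [x], [f] is a quotient of polynomials, which is nonzero wherever numerator and denominator
    are; both conditions are open. *)
Lemma affine_regular_neq0_near (x : A) (f : A -> k) :
  affine_regular_at x f -> f x != 0 -> \forall y \near x, f y != 0.
Proof.
move=> [p [q [qx fE]]]; have [_ ->] := nbhs_singleton fE.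
rewrite mulf_eq0 invr_eq0 (negbTE qx) orbF => /poly_fun_neq0_near px.
near=> y.
have [qy ->] : poly_fun q y != 0 /\ f y = poly_fun p y / poly_fun q y by near: y.
by rewrite mulf_neq0 ?invr_neq0//; near: y.
Unshelve. all: by end_near.
Qed.

Lemma affine_space_nonvanishing (x : A) : nonvanishing_near x.
Proof.
move=> m a b bx; apply: (@affine_regular_neq0_near x (fun y => _)).
apply: affine_regular_sum => i; apply: affine_regularM (bx i).
exact: affine_regular_cst (a i).
Qed.

Lemma affine_space_closed1 (x : A) : closed [set x].
Proof.
rewrite -[[set x]]setCK; apply: open_closedC.
(* The coordinate equations [T_i = x i] cut out the point [x]. *)
exists [set p | exists i, p = mpolyX k (mnm1 i) - mpolyC n (x i)].
congr (~` _); apply/seteqP; split=> y /=.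
  by move=> -> _ [i ->]; rewrite mevalB mevalXU mevalC subrr.
move=> y0; apply/funext => i.
have /eqP := y0 _ (ex_intro _ i erefl).
by rewrite mevalB mevalXU mevalC subr_eq0 => /eqP.
Qed.

End AffineSpace.

(** * Transfer along subspaces, retracts and open covers *)

Section Locality.
Context {k : closedFieldType}.

(** A neighbourhood in [U] contains the trace of some open [B], and [B] meets [U] in an open set of
    the whole space. *)
Lemma open_set_val_near (T : topologicalType) (U : set T) (a : set_type U)
    (P : set T) :
  open U -> (\forall b \near a, P (set_val b)) ->
  \forall x \near set_val a, P x.
Proof.
move=> oU aP; have : nbhs a (P \o set_val) by [].
rewrite nbhsE => -[_ [[B oB <-] Ba] BP].
have : nbhs (set_val a) (B `&` U).
  by apply: open_nbhs_nbhs; split; [exact: openI|split=> //; exact: set_valP].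
by apply: filterS => x [Bx Ux]; exact: (BP (SigSub (mem_set Ux)) Bx).
Qed.

(** The finitely many [b i] agree, on one common neighbourhood of [a], with restrictions of
    functions regular on the ambient space. *)
Lemma sub_nonvanishing (X : funSpaceType k) (A : set X) (a : set_type A) :
  nonvanishing_near (set_val a) -> nonvanishing_near a.
Proof.
move=> Xa n c b ra.
have /choice[g gP] : forall i, exists g : X -> k, regular_at (set_val a) g /\
    \forall y \near a, b i y = g (set_val y).
  by move=> i; have [g] := ra i; exists g.
have bg : \forall y \near a, forall i, b i y = g i (set_val y).
  apply: (@filter_forall _ _ (fun i y => b i y = g i (set_val y)) (nbhs a) _).
  by move=> i; case: (gP i).
rewrite (eq_bigr (fun i => c i * g i (set_val a))); last first.
  by move=> i _; rewrite (nbhs_singleton bg).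
move=> /(Xa _ _ _ (fun i => proj1 (gP i)))/set_val_near gn.
near=> y; rewrite (eq_bigr (fun i => c i * g i (set_val y))).
  by near: y.
by move=> i _; congr (_ * _); move: i; near: y.
Unshelve. all: by end_near.
Qed.

Lemma open_nonvanishing (X : funSpaceType k) (U : set X) (a : set_type U) :
  open U -> nonvanishing_near a -> nonvanishing_near (set_val a).
Proof.
move=> oU Ua n c b rb ba; apply: open_set_val_near => //.
apply: (Ua n c (fun i => b i \o set_val)) => // i.
exact: (set_val_regular U).2.
Qed.

(** Each [b i \o psi] is regular at [phi x] because [psi (phi x) = x]; the neighbourhood found in
    [Z] is pulled back by [phi]. *)
Lemma retract_nonvanishing (X Z : funSpaceType k) (phi : X -> Z)
    (psi : Z -> X) (x : X) :
  regular_morphism phi -> regular_morphism psi -> cancel phi psi ->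
  nonvanishing_near (phi x) -> nonvanishing_near x.
Proof.
move=> [cphi _] [_ rpsi] phiK Zx n a b bx bx0.
have bn : \forall z \near phi x, \sum_(i < n) a i * (b i \o psi) z != 0.
  apply: Zx; last by rewrite /= phiK.
  by move=> i; apply: rpsi; rewrite phiK.
by apply: (filterS (F := nbhs x) _ (cphi x _ bn)) => y /=; rewrite phiK.
Qed.

Lemma injective_closed1 (T S : topologicalType) (f : T -> S) (x : T) :
  continuous f -> injective f -> closed [set f x] -> closed [set x].
Proof.
move=> cf fI; suff -> : [set x] = f @^-1` [set f x].
  by move/continuous_closedP: cf; apply.
by apply/seteqP; split=> y /=; [move=> ->|exact: fI].
Qed.

(** If [y] is in the closure of [x], any chart around [y] also contains [x]; were they distinct,
    closedness of [x] in that chart would give a neighbourhood of [y] missing [x]. *)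
Lemma open_cover_closed1 (T : topologicalType) (I : Type) (U : I -> set T) :
  (forall i, open (U i)) -> \bigcup_i U i = setT ->
  (forall i (a : set_type (U i)), closed [set a]) ->
  forall x : T, closed [set x].
Proof.
move=> oU UT Ucl x y xy; apply: contrapT => yx.
have [i _ Uy] : (\bigcup_i U i) y by rewrite UT.
have [_ [-> Ux]] := xy _ (open_nbhs_nbhs (conj (oU i) Uy)).
have [B oB BE] := closed_openC (Ucl i (SigSub (mem_set Ux))).
have By : B y.
  suff : (set_val @^-1` B) (SigSub (mem_set Uy) : set_type (U i)) by [].
  by rewrite BE => /(congr1 set_val).
have [_ [-> Bx]] := xy _ (open_nbhs_nbhs (conj oB By)).
suff : (~` [set SigSub (mem_set Ux) : set_type (U i)]) (SigSub (mem_set Ux)).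
  by apply.
by rewrite -BE.
Qed.

End Locality.

(** * Passage from affine charts to varieties *)

Section Varieties.
Context {k : closedFieldType}.

Lemma affine_nonvanishing (X : funSpaceType k) (x : X) :
  affine X -> nonvanishing_near x.
Proof.
move=> [n [Z [_ [phi [psi [rphi rpsi phiK _]]]]]].
apply: (retract_nonvanishing rphi rpsi phiK); apply: sub_nonvanishing.
exact: affine_space_nonvanishing.
Qed.

Lemma affine_closed1 (X : funSpaceType k) (x : X) : affine X -> closed [set x].
Proof.
move=> [n [Z [_ [phi [psi [[cphi _] _ phiK _]]]]]].
apply: (@injective_closed1 _ _ phi x cphi (can_inj phiK)).
apply: (@injective_closed1 _ _ (set_val : set_type Z -> _)).
- exact: initial_continuous.
- exact: val_inj.
- exact: affine_space_closed1.
Qed.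

Lemma variety_nonvanishing (X : varietyType k) (x : X) : nonvanishing_near x.
Proof.
have [n [U [oU aU UT]]] := @variety_affine_cover k X.
have [i _ Ux] : (\bigcup_i U i) x by rewrite UT.
apply: (@open_nonvanishing _ _ (U i) (SigSub (mem_set Ux)) (oU i)).
exact: affine_nonvanishing (aU i).
Qed.

Lemma variety_closed1 (X : varietyType k) (x : X) : closed [set x].
Proof.
have [n [U [oU aU UT]]] := @variety_affine_cover k X.
by apply: (open_cover_closed1 oU UT) => i a; exact: affine_closed1 (aU i).
Qed.

(** It suffices to treat subbasic open sets. With [x] fixed, the tensor becomes a combination of the
    [b i] with constant coefficients [a i x], so its nonvanishing is open. *)
Lemma zprod_pair_continuous (X : funSpaceType k) (Y : varietyType k) (x : X) :
  continuous (fun y : Y => (x, y) : zprod X Y).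
Proof.
apply/continuousP => _ [D DP <-]; rewrite preimage_bigcup.
apply: bigcup_open => _ /DP[F FP <-]; rewrite preimage_bigcap.
apply: fset_bigcap_open => W /FP/set_mem[U [V [n [a [b [oU oV ra rb ->]]]]]].
rewrite openE => y [/= Ux Vy aby].
have aby' : \forall z \near y, \sum_(i < n) a i x * b i z != 0.
  by apply: variety_nonvanishing => // i; exact: rb.
have Vy' : \forall z \near y, V z by exact: open_nbhs_nbhs.
by apply: filterS2 Vy' aby' => z Vz abz.
Qed.

End Varieties.

(** * Continuity of translations and closures of saturations *)

Section Actions.
Context {k : closedFieldType} {G : funGroupType k} {X : varietyType k}.
Variable alpha : regularAction G X.

Lemma act_continuous (g : G) : continuous (alpha g).
Proof.
have [calpha _] := act_regular alpha; move=> x B gxB.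
exact: (zprod_pair_continuous (calpha (g, x) B gxB)).
Qed.

(** A neighbourhood of [g x] pulls back along [alpha g] to one of [x], which meets the saturation in
    some [h w]; then [(g h) w] lies in the original neighbourhood. *)
Lemma closure_translates_invariant (W : set X) :
  invariant_set alpha setT (closure (translates alpha setT W)).
Proof.
move=> _ [g _ [x Wx <-]] B /act_continuous/Wx[_ [[h _ [w Ww <-]] Bw]].
exists (alpha g (alpha h w)); split=> //.
by exists (g * h)%g => //; exists w => //; rewrite actM.
Qed.

Lemma sub_closure_translates (W : set X) :
  W `<=` closure (translates alpha setT W).
Proof.
move=> w Ww; apply: subset_closure; exists 1%g => //.
by exists w => //; rewrite act1.
Qed.

End Actions.

(** Links closed sets of the space [set_type Y], as in [pseudo_quotient], to the subsets of [X] used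
    in [core]. *)
Lemma closed_in_set_val (k : closedFieldType) (X : funSpaceType k) (Y : set X)
    (W : set (set_type Y)) :
  closed W -> closed_in Y (set_val @` W).
Proof.
move=> /closed_openC[B oB BE]; exists (~` B); first exact: open_closedC.
have WB (w : set_type Y) : W w <-> ~ B (set_val w).
  by rewrite -[W]setCK -BE.
apply/seteqP; split=> [_ [w Ww <-]|x [Yx Bx]].
  by split; [exact: set_valP|exact/WB].
by exists (SigSub (mem_set Yx)) => //; apply/WB.
Qed.

Theorem proposition5p11 (k : closedFieldType) (X : varietyType k)
    (G : algGroupType k) (alpha : regularAction G X)
    (Y : set X) (H : closedSubgroup G) (c : core alpha Y H)
    (Xbar : varietyType k) (pi : X -> Xbar) :
  pseudo_quotient alpha pi ->
  pseudo_quotient (core_action c) (pi \o (set_val : set_type Y -> X)).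
Proof.
move=> [rpi pi_surj pi_inv pi_sep]; split.
- exact: comp_regular (set_val_regular Y) rpi.
- move=> y; have [x xy] := pi_surj y.
  have [z [xz Yz]] := core_meets c x.
  exists (SigSub (mem_set Yz)) => /=.
  (* The fibre over [y] is closed and contains the orbit of [x], hence also the point [z] of its
     closure. *)
  have fib : closed (pi @^-1` [set y]).
    by move/continuous_closedP: rpi.1; apply; exact: variety_closed1.
  apply: (fib z); move: xz; apply: closureS => _ [g _ [_ -> <-]] /=.
  by rewrite pi_inv.
- by move=> g x; exact: pi_inv.
move=> W1 W2 cW1 cW2 iW1 iW2 W12.
have iW (W : set (set_type Y)) : invariant_set (core_action c) setT W ->
    invariant_set alpha H (set_val @` W).
  move=> iW _ [h Hh [_ [w Ww <-] <-]].
  exists (core_act c (SigSub (mem_set Hh)) w) => //.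
  by apply: iW; exists (SigSub (mem_set Hh)) => //; exists w.
have disj : (set_val @` W1) `&` (set_val @` W2) = set0.
  rewrite -subset0 => _ [[w1 Ww1 <-] [w2 Ww2 /val_inj w12]].
  by have : (W1 `&` W2) w1; [split=> //; rewrite -w12|rewrite W12].
have := core_separates c (closed_in_set_val cW1) (closed_in_set_val cW2)
  (iW _ iW1) (iW _ iW2) disj.
move/(pi_sep _ _ (@closed_closure _ _) (@closed_closure _ _)
  (@closure_translates_invariant _ _ _ alpha _)
  (@closure_translates_invariant _ _ _ alpha _)).
rewrite -!subset0; apply: subset_trans.
by apply: setISS; rewrite -image_comp; apply: closureS;
  apply: image_subset; exact: sub_closure_translates.
Qed.
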